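(* For $-2\pi<\theta<2\pi$ let $\widehat D_\theta=\inf_{(x,v)\in\Gamma_\theta}d_H((0,1),(x,v))$. Then: (1) if $0\le|\theta|<\pi$, then $\widehat D_\theta=|\theta|=d_H\big((0,1),(\frac{\theta+\sin\theta}{2},\cos^2\frac{\theta}{2})\big)$; (2) if $\pi\le|\theta|<2\pi$, then $\widehat D_\theta=\theta\big(\sin\frac{\theta}{2}\big)^{-1}=d_H\big((0,1),(\frac{\theta-\sin\theta}{1-\cos\theta},0)\big)$.
   Context: Let $\mathcal{H}=\{(x,v)\in\mathbb{R}^2:v\ge0\}$ and let $d_H$ be the Riemannian distance on $\mathcal{H}$ induced by the metric $ds^2=v^{-1}(dx^2+dv^2)$ on the open upper half-plane (extended to the boundary). For $v\ge0$ and $0<|\delta|<2\pi$ set $$f(v,\delta)=\frac{(v+1)(\delta-\sin\delta)+2\sqrt v\,(2\sin\frac{\delta}{2}-\delta\cos\frac{\delta}{2})}{2\sin^2\frac{\delta}{2}},$$ and $f(v,0)=0$. For $(x,v)\in\mathcal{H}$, $\delta(x,v)$ denotes the unique $\delta\in(-2\pi,2\pi)$ with $f(v,\delta)=x$, and $\Gamma_\theta=\{(x,v)\in\mathcal{H}:\delta(x,v)=\theta\}$. *)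

(* Defs.v *)
From HB Require Import structures.
From mathcomp Require Import all_boot all_order all_algebra.
From mathcomp Require Import all_classical all_reals all_analysis.
Set Implicit Arguments. Unset Strict Implicit. Unset Printing Implicit Defensive.
Import Order.TTheory GRing.Theory Num.Theory.
Import numFieldNormedType.Exports.
Local Open Scope classical_set_scope.
Local Open Scope ring_scope.

Section Grushin.
Variable R : realType.

Definition fH (v d : R) : R :=
  if d == 0 then 0 else
  ((v + 1) * (d - sin d) + 2 * Num.sqrt v * (2 * sin (d / 2) - d * cos (d / 2)))
  / (2 * sin (d / 2) ^+ 2).

Definition C1 (g : R -> R) : Prop :=
  (forall t : R, derivable g t 1) /\ continuous (derive1 g).

(* Length density of the metric ds^2 = v^{-1}(dx^2+dv^2), extended to the
   boundary v = 0 (infinite unless the curve is at rest there). *)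
Definition speedH (gx gv : R -> R) (t : R) : \bar R :=
  let s := Num.sqrt (derive1 gx t ^+ 2 + derive1 gv t ^+ 2) in
  if gv t == 0 then (if s == 0 then 0%E else +oo%E)
  else (s / Num.sqrt (gv t))%:E.

Definition lengthH (gx gv : R -> R) : \bar R :=
  (\int[@lebesgue_measure R]_(t in `[0%R, 1%R]) speedH gx gv t)%E.

Definition curveH (p q : R * R) (gx gv : R -> R) : Prop :=
  [/\ C1 gx, C1 gv,
      (forall t, 0 <= t <= 1 -> 0 <= gv t),
      (gx 0, gv 0) = p & (gx 1, gv 1) = q].

Definition dH (p q : R * R) : \bar R :=
  ereal_inf [set L | exists gx gv, curveH p q gx gv /\ L = lengthH gx gv].

(* Gamma_theta: points (x,v) in H with delta(x,v) = theta, where delta(x,v)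
   is the unique delta in (-2pi,2pi) with f(v,delta) = x. *)
Definition Gamma (th : R) : set (R * R) :=
  [set p | 0 <= p.2 /\ - (2 * pi) < th < 2 * pi /\ fH p.2 th = p.1 /\
           (forall d, - (2 * pi) < d < 2 * pi -> fH p.2 d = p.1 -> d = th)].

Definition Dhat (th : R) : \bar R :=
  ereal_inf [set dH (0, 1) p | p in Gamma th].

End Grushin.

(* Main.v *)
Require Import Defs.
From HB Require Import structures.
From mathcomp Require Import all_boot all_order all_algebra.
From mathcomp Require Import all_classical all_reals all_analysis.
From mathcomp Require Import measurable_realfun ring lra.
Set Implicit Arguments. Unset Strict Implicit. Unset Printing Implicit Defensive.
Import Order.TTheory GRing.Theory Num.Theory.
Import numFieldNormedType.Exports.
Local Open Scope classical_set_scope.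
Local Open Scope ring_scope.

(** Geodesics of the metric are cycloids: along one of length D from (0, 1) to
    (x, u^2), sqrt v is a sinusoid in arclength whose phase turns by
    a = delta / 2, and the law of cosines gives
    D = 2 a sqrt(1 + u^2 - 2 u cos a) / sin a.
    Minimality of D for arbitrary curves comes from a calibration: with
    l(t) the arclength and c solving the Riccati equation
    c' = - (P^2 + c^2) / 2, the Cauchy-Schwarz inequality shows that
    l - 2 P x - 2 c(l) v is nondecreasing along every curve; taking P and c from
    the cycloid, the endpoint values contradict any total length below D.
    Minimizing D over u >= 0 gives u = cos a when cos a > 0, and u = 0 otherwise,
    and at these two points the cycloid is an explicit C^1 curve.  That they lie
    on Gamma requires the injectivity of f(v, .), an odd function with positive
    derivative on (0, 2 pi). *)

(** * Derivatives of explicit functions *)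

Section PointwiseDerivatives.
Variable R : realType.
Implicit Types (f g : R -> R) (x a b : R).

Lemma is_derive_fun_cst (k x : R) : is_derive x 1 (fun=> k) 0.
Proof. exact: is_derive_cst. Qed.

Lemma is_derive_fun_id x : is_derive x 1 (fun t : R => t) 1.
Proof. exact: is_derive_id. Qed.

Lemma is_derive_funD f g x a b : is_derive x 1 f a -> is_derive x 1 g b ->
  is_derive x 1 (fun t => f t + g t) (a + b).
Proof. by move=> ? ?; exact: is_deriveD. Qed.

Lemma is_derive_funN f x a : is_derive x 1 f a ->
  is_derive x 1 (fun t => - f t) (- a).
Proof. by move=> ?; exact: is_deriveN. Qed.

Lemma is_derive_funM f g x a b : is_derive x 1 f a -> is_derive x 1 g b ->
  is_derive x 1 (fun t => f t * g t) (f x * b + g x * a).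
Proof. by move=> ? ?; exact: is_deriveM. Qed.

Lemma is_derive_funV f x a : f x != 0 -> is_derive x 1 f a ->
  is_derive x 1 (fun t => (f t)^-1) (- (f x) ^- 2 * a).
Proof. by move=> fx0 ?; exact: is_deriveV. Qed.

Lemma is_derive_fun_comp f g x a b : is_derive (g x) 1 f a ->
  is_derive x 1 g b -> is_derive x 1 (fun t => f (g t)) (a * b).
Proof. by move=> fa gb; exact: is_derive1_comp. Qed.

Lemma is_derive_fun_sqr f x a : is_derive x 1 f a ->
  is_derive x 1 (fun t => f t ^+ 2) (2 * f x * a).
Proof.
move=> fa; have := is_derive_funM fa fa;
have -> //: f x * a + f x * a = 2 * f x * a by ring.
Qed.

Lemma is_derive_fun_sin g x b : is_derive x 1 g b ->
  is_derive x 1 (fun t => sin (g t)) (cos (g x) * b).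
Proof. by apply: is_derive_fun_comp; exact: is_derive_sin. Qed.

Lemma is_derive_fun_cos g x b : is_derive x 1 g b ->
  is_derive x 1 (fun t => cos (g t)) (- sin (g x) * b).
Proof. by apply: is_derive_fun_comp; exact: is_derive_cos. Qed.

Lemma is_derive_continuous f x a : is_derive x 1 f a -> {for x, continuous f}.
Proof.
by move=> fa; apply/differentiable_continuous/derivable1_diffP; case: fa.
Qed.

Lemma is_derive_C1 f g : (forall x, is_derive x 1 f (g x)) -> continuous g ->
  C1 f.
Proof.
move=> fg cg; split=> [t|]; first by case: (fg t).
by have -> : derive1 f = g by apply/funext => t; rewrite derive1E; case: (fg t).
Qed.

Lemma ger0_is_derive_le f g a b : a <= b ->
  (forall x, a <= x <= b -> is_derive x 1 f (g x)) ->
  (forall x, a <= x <= b -> 0 <= g x) -> f a <= f b.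
Proof.
move=> ab fg g0.
have io x : x \in `]a, b[ -> a <= x <= b.
  by rewrite in_itv/= => /andP[/ltW -> /ltW ->].
apply: (@ger0_derive1_ndecr _ f a b) => // [x /io /fg []//|x /io xab|].
  by rewrite derive1E; case: (fg _ xab) => _ ->; exact: g0.
apply: derivable_within_continuous => x.
by rewrite in_itv/= => /fg[].
Qed.

(** Positivity is asked on the open interval only, because derivatives used below, such as
    [t * sin t], vanish at the endpoint 0. *)
Lemma gtr0_is_derive_lt f g a b : a < b ->
  (forall x, a <= x <= b -> is_derive x 1 f (g x)) ->
  (forall x, a < x < b -> 0 < g x) -> f a < f b.
Proof.
move=> ab fg g0.
have io x : x \in `]a, b[ -> a <= x <= b.
  by rewrite in_itv/= => /andP[/ltW -> /ltW ->].
apply: (@gtr0_derive1_incr _ f a b) => // [x /io /fg []//|x xab|].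
  by rewrite derive1E; case: (fg _ (io _ xab)) => _ ->; apply: g0; rewrite in_itv in xab.
apply: derivable_within_continuous => x.
by rewrite in_itv/= => /fg[].
Qed.

End PointwiseDerivatives.

(* The rules are selected by the syntax of the function: left to unification,
   they make Rocq unfold the ring structure of [R] without end. *)
Ltac derive_step :=
  first [ eassumption | lazymatch goal with |- is_derive _ _ ?F _ =>
  lazymatch F with
  | fun t => t => notypeclasses refine (is_derive_fun_id _)
  | fun t => @GRing.add _ (@?f t) (@?g t) =>
      notypeclasses refine (@is_derive_funD _ f g _ _ _ _ _)
  | fun t => @GRing.opp _ (@?f t) =>
      notypeclasses refine (@is_derive_funN _ f _ _ _)
  | fun t => @GRing.mul _ (@?f t) (@?g t) =>
      notypeclasses refine (@is_derive_funM _ f g _ _ _ _ _)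
  | fun t => @GRing.exp _ (@?f t) 2 =>
      notypeclasses refine (@is_derive_fun_sqr _ f _ _ _)
  | fun t => @GRing.inv _ (@?f t) =>
      notypeclasses refine (@is_derive_funV _ f _ _ _ _)
  | fun t => @sin _ (@?f t) =>
      notypeclasses refine (@is_derive_fun_sin _ f _ _ _)
  | fun t => @cos _ (@?f t) =>
      notypeclasses refine (@is_derive_fun_cos _ f _ _ _)
  | _ => notypeclasses refine (is_derive_fun_cst _ _)
  end end ].
Ltac derive_fun := notypeclasses refine (is_derive_eq _ _); [repeat derive_step|cbv beta].

(** * The function f in the half-angle *)

Section Trigonometry.
Variable R : realType.
Implicit Types a b x y u v d : R.

Lemma mul_cos_lt_sin a : 0 < a < pi -> a * cos a < sin a.
Proof.
move=> /andP[a0 api].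
have df (t : R) : is_derive t 1 (fun t => sin t - t * cos t) (t * sin t).
  by derive_fun; ring.
have := @gtr0_is_derive_lt _ _ _ 0 a a0 (fun t _ => df t).
rewrite sin0 mul0r subr0 subr_gt0; apply=> t /andP[t0 ta].
by apply: mulr_gt0 => //; apply: sin_gt0_pi; rewrite t0 (lt_trans ta).
Qed.

Lemma sin_mul_cos_lt a : 0 < a < pi -> sin a * cos a < a.
Proof.
move=> /andP[a0 api].
have df (t : R) : is_derive t 1 (fun t => t - sin t * cos t) (2 * sin t ^+ 2).
  by derive_fun; ring: (cos2sin2 t).
have := @gtr0_is_derive_lt _ _ _ 0 a a0 (fun t _ => df t).
rewrite sin0 mul0r subr0 subr_gt0; apply=> t /andP[t0 ta].
by rewrite mulr_gt0// exprn_gt0// sin_gt0_pi// t0 (lt_trans ta).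
Qed.

(** By the law of cosines, the squared third side of a triangle with sides 1 and [u] enclosing the
    angle [a]. *)
Definition chord2 u a : R := 1 + u ^+ 2 - 2 * u * cos a.

(** Completing the square in [u] shows both positivity and the minimizer [u = cos a]. *)
Lemma chord2E u a : chord2 u a = sin a ^+ 2 + (u - cos a) ^+ 2.
Proof. by rewrite /chord2 sin2cos2; ring. Qed.

Lemma chord2_gt0 u a : 0 < a < pi -> 0 < chord2 u a.
Proof.
move=> /sin_gt0_pi s0.
by rewrite chord2E ltr_wpDr ?sqr_ge0 ?exprn_gt0.
Qed.

(* [fH (u ^+ 2) (2 * a)] with the terms linear in [a] collected. *)
Definition fH_angle u a : R :=
  a * chord2 u a / sin a ^+ 2 - ((u ^+ 2 + 1) * cos a - 2 * u) / sin a.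

Lemma fH_half u a : 0 <= u -> 0 < a < pi ->
  fH (u ^+ 2) (2 * a) = fH_angle u a.
Proof.
move=> u0 /[dup] /andP[a0 _] /sin_gt0_pi s0.
have a2 : 2 * a / 2 = a by field.
have s2 : sin (2 * a) = 2 * sin a * cos a.
  by rewrite mulr_natl sin_mulr2n mulr2n; ring.
rewrite /fH mulf_eq0 pnatr_eq0 (gt_eqF a0) /= a2 s2 sqrtr_sqr ger0_norm//.
rewrite /fH_angle /chord2; field; exact: lt0r_neq0.
Qed.

End Trigonometry.

(** * Monotonicity and injectivity of f(v, .) *)

Section Monotonicity.
Variable R : realType.
Implicit Types a b x y u v d : R.

(** The derivative is arranged so that, for [0 <= u] and [t] in (0, pi), each summand has a visible
    sign, the first by [mul_cos_lt_sin]. *)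
Lemma is_derive_fH_angle u t : sin t != 0 -> is_derive t 1 (fH_angle u)
  (2 * chord2 u t * (sin t - t * cos t) / sin t ^+ 3 + 2 * u * t / sin t).
Proof.
move=> s0; rewrite /fH_angle /chord2.
derive_fun; first by rewrite expf_neq0.

by field: (sin2cos2 t).
Qed.

Lemma fH_angle_lt u a b : 0 <= u -> 0 < a -> a < b -> b < pi ->
  fH_angle u a < fH_angle u b.
Proof.
move=> u0 a0 ab bpi.
have inpi t : a <= t <= b -> 0 < t < pi.
  by move=> /andP[at_ tb]; rewrite (lt_le_trans a0)//= (le_lt_trans tb).
have df t : a <= t <= b -> _ :=
  fun tab => is_derive_fH_angle u (lt0r_neq0 (sin_gt0_pi (inpi t tab))).
apply: (gtr0_is_derive_lt ab df) => t /andP[/ltW at_ /ltW tb].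
have /inpi tpi : a <= t <= b by rewrite at_.
have s0 := sin_gt0_pi tpi.
apply: ltr_pwDl.
  rewrite divr_gt0 ?exprn_gt0// mulr_gt0 ?subr_gt0 ?mul_cos_lt_sin//.
  by rewrite mulr_gt0 ?chord2_gt0.
by rewrite divr_ge0 ?(ltW s0)// mulr_ge0 ?mulr_ge0// (le_trans (ltW a0)).
Qed.

Lemma fH_angle_gt0 u a : 0 <= u -> 0 < a < pi -> 0 < fH_angle u a.
Proof.
move=> u0 api; have s0 := sin_gt0_pi api.
have -> : fH_angle u a = ((u ^+ 2 + 1) * (a - sin a * cos a) +
    2 * u * (sin a - a * cos a)) / sin a ^+ 2.
  by rewrite /fH_angle /chord2; field; rewrite lt0r_neq0.
rewrite divr_gt0 ?exprn_gt0// ltr_pwDl//.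
  by rewrite mulr_gt0 ?subr_gt0 ?sin_mul_cos_lt// ltr_wpDl ?sqr_ge0.
by rewrite mulr_ge0 ?subr_ge0 ?mulr_ge0 ?(ltW (mul_cos_lt_sin _)).
Qed.

Lemma fHN v d : fH v (- d) = - fH v d.
Proof.
rewrite /fH oppr_eq0; case: eqP => [_|_]; first by rewrite oppr0.
by rewrite mulNr !sinN cosN sqrrN -[RHS]mulNr; congr (_ / _); ring.
Qed.

Lemma fH_gt0 v d : 0 <= v -> 0 < d < 2 * pi -> 0 < fH v d.
Proof.
move=> v0 /andP[d0 dpi].
rewrite -(sqr_sqrtr v0) (_ : d = 2 * (d / 2)); last by field.
have a : 0 < d / 2 < pi by rewrite divr_gt0//= ltr_pdivrMr// mulrC.
by rewrite fH_half ?sqrtr_ge0//; apply: fH_angle_gt0; rewrite ?sqrtr_ge0.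
Qed.

Lemma fH_lt v d e : 0 <= v -> 0 < d -> d < e -> e < 2 * pi -> fH v d < fH v e.
Proof.
move=> v0 d0 de epi.
rewrite -(sqr_sqrtr v0) (_ : d = 2 * (d / 2)) 1?(_ : e = 2 * (e / 2)); try by field.
have a0 : 0 < d / 2 by rewrite divr_gt0.
have ab : d / 2 < e / 2 by rewrite ltr_pM2r// invr_gt0.
have bpi : e / 2 < pi by rewrite ltr_pdivrMr// mulrC.
rewrite !fH_half ?sqrtr_ge0 ?a0 ?bpi ?(lt_trans ab) ?(lt_trans a0)//.
by apply: fH_angle_lt; rewrite ?sqrtr_ge0.
Qed.

Lemma fH_inj v d e : 0 <= v -> - (2 * pi) < d < 2 * pi ->
  - (2 * pi) < e < 2 * pi -> fH v d = fH v e -> d = e.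
Proof.
move=> v0.
wlog de : d e / d < e.
  move=> H hd he fde; have [de|ed|//] := ltgtP d e; first exact: H.
  by apply/esym/H.
move=> /andP[d1 d2] /andP[e1 e2] fde.
suff : fH v d < fH v e by rewrite fde ltxx.
have fH0 : fH v 0 = 0 by rewrite /fH eqxx.
(* Two negative arguments are reflected by oddness, two positive ones are compared by [fH_lt], and
   in the remaining cases the value 0 separates the two. *)
have [d0|d0|d0] := ltgtP d 0.
- have fd : fH v d < 0.
    by rewrite -(opprK d) fHN oppr_lt0 fH_gt0 ?oppr_gt0 ?d0//= ltrNl.
  have [e0|e0|->] := ltgtP e 0; last by rewrite fH0.
    rewrite -(opprK d) -(opprK e) fHN (fHN _ (- e)) ltrN2.
    by apply: fH_lt; rewrite ?oppr_gt0 ?ltrN2 1?ltrNl.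
  by rewrite (lt_trans fd)// fH_gt0 ?e0.
- by apply: fH_lt.
- by rewrite d0 fH0 fH_gt0// -d0 de.
Qed.

End Monotonicity.

(** * Calibration *)

Section Calibration.
Variable R : realType.
Implicit Types (X V l dX dV dl c : R -> R).

(** Cauchy-Schwarz bounds the square of [P * x + c * v] by [A * (y ^+ 2 * V)]; then
    [4 * A * V <= (1 + A * V) ^+ 2] finishes. *)
Lemma speed_calibration (x v y V A P c : R) : 0 <= y -> 0 <= V ->
  A = P ^+ 2 + c ^+ 2 -> y ^+ 2 * V = x ^+ 2 + v ^+ 2 ->
  2 * (P * x + c * v) <= y * (1 + A * V).
Proof.
move=> y0 V0 AE yV.
have A0 : 0 <= A by rewrite AE addr_ge0 ?sqr_ge0.
have r0 : 0 <= y * (1 + A * V) by rewrite mulr_ge0 ?addr_ge0 ?mulr_ge0.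
have [b0|b0] := leP (P * x + c * v) 0.
  by apply: le_trans r0; rewrite pmulr_rle0.
rewrite -ler_sqr ?nnegrE//; last by rewrite mulr_ge0 ?(ltW b0).
have CS : (P * x + c * v) ^+ 2 <= A * (y ^+ 2 * V).
  rewrite yV AE -subr_ge0.
  have -> : (P ^+ 2 + c ^+ 2) * (x ^+ 2 + v ^+ 2) - (P * x + c * v) ^+ 2 =
    (P * v - c * x) ^+ 2 by ring.
  exact: sqr_ge0.
rewrite exprMn; apply: le_trans (ler_wpM2l _ CS) _; first exact: sqr_ge0.
rewrite -subr_ge0.
have -> : (y * (1 + A * V)) ^+ 2 - 2 ^+ 2 * (A * (y ^+ 2 * V)) =
  (y * (1 - A * V)) ^+ 2 by ring.
exact: sqr_ge0.
Qed.

(** By the Riccati equation, the derivative of the calibrated quantity is exactly the difference of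
    the two sides of [speed_calibration]. *)
Lemma calibrated_length X V l dX dV dl c (P : R) :
  (forall t : R, 0 <= t <= 1 -> is_derive t 1 X (dX t)) ->
  (forall t : R, 0 <= t <= 1 -> is_derive t 1 V (dV t)) ->
  (forall t : R, 0 <= t <= 1 -> is_derive t 1 l (dl t)) ->
  (forall t : R, 0 <= t <= 1 ->
    [/\ 0 <= V t, 0 <= dl t & dl t ^+ 2 * V t = dX t ^+ 2 + dV t ^+ 2]) ->
  (forall t : R, 0 <= t <= 1 ->
    is_derive (l t) 1 c (- ((P ^+ 2 + c (l t) ^+ 2) / 2))) ->
  l 0 - 2 * P * X 0 - 2 * c (l 0) * V 0 <= l 1 - 2 * P * X 1 - 2 * c (l 1) * V 1.
Proof.
move=> HX HV Hl Hs Hc.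
apply: (@ger0_is_derive_le _ (fun t => l t - 2 * P * X t - 2 * c (l t) * V t)
  (fun t => dl t * (1 + (P ^+ 2 + c (l t) ^+ 2) * V t)
            - 2 * (P * dX t + c (l t) * dV t))) => // t t01.
- have ? := HX t t01; have ? := HV t t01; have ? := Hl t t01.
  have ? := is_derive_fun_comp (Hc t t01) (Hl t t01).
  by derive_fun; field.
- have [V0 l0 lV] := Hs t t01.
  by rewrite subr_ge0; apply: speed_calibration.
Qed.

(* [prof u a] is proportional to sqrt v along the cycloid joining height 1 at
   parameter 0 to height u^2 at parameter a; its logarithmic derivative solves
   the Riccati equation required of a calibration. *)
Definition prof (u a s : R) : R := sin (a - s) + u * sin s.
Definition dprof (u a s : R) : R := u * cos s - cos (a - s).
Definition calib (u a p l : R) : R :=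
  p * (dprof u a (p * l / 2) / prof u a (p * l / 2)).

Lemma prof_gt0 u a s : 0 <= u -> 0 <= s < a -> a < pi -> 0 < prof u a s.
Proof.
move=> u0 /andP[s0 sa] api; rewrite /prof ltr_pwDl//.
  by rewrite sin_gt0_pi// subr_gt0 sa (le_lt_trans _ api)// gerBl.
by rewrite mulr_ge0// sin_ge0_pi// s0 ltW// (lt_trans sa).
Qed.

Lemma is_derive_calib (u a p l : R) : prof u a (p * l / 2) != 0 ->
  is_derive l 1 (calib u a p) (- ((p ^+ 2 + calib u a p l ^+ 2) / 2)).
Proof.
rewrite /calib /prof /dprof => n0.
derive_fun; try by rewrite pnatr_eq0.
by field.
Qed.

(** [prof] is a sinusoid of amplitude [Num.sqrt (chord2 u a)] and [dprof] is its derivative, so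
    [calib] is [p] times a cotangent, which decreases between poles. *)
Lemma calib_le (u a p k l : R) : 0 <= u -> 0 < a < pi -> 0 < p -> 0 <= k -> k <= l ->
  p * l / 2 < a -> calib u a p l <= calib u a p k.
Proof.
move=> u0 api p0 k0 kl la.
have kle : p * k / 2 <= p * l / 2 by rewrite ler_pM2r ?invr_gt0// ler_pM2l.
have k20 : 0 <= p * k / 2 by rewrite divr_ge0// mulr_ge0// ltW.
case/andP: (api) => a0 ap.
have Wk : 0 < prof u a (p * k / 2) by apply: prof_gt0; rewrite // k20 (le_lt_trans kle).
have Wl : 0 < prof u a (p * l / 2) by apply: prof_gt0; rewrite // la (le_trans k20).
rewrite /calib ler_pM2l// ler_pdivrMr// [leRHS]mulrAC ler_pdivlMr//.
move: k20 kle la; set s := p * k / 2; set t := p * l / 2 => s0 st ta.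
rewrite -subr_ge0.
(* For a sinusoid and its derivative at two phases, this cross difference is the squared amplitude
   times the sine of the phase shift. *)
have -> : dprof u a s * prof u a t - dprof u a t * prof u a s =
    chord2 u a * sin (t - s).
  rewrite /dprof /prof /chord2 !sinB !cosB.
  ring: (sin2cos2 a) (sin2cos2 s) (sin2cos2 t).
rewrite mulr_ge0 ?(ltW (chord2_gt0 _ _))// sin_ge0_pi// subr_ge0 st.
by rewrite (le_trans _ (ltW (lt_trans ta ap)))// gerBl.
Qed.

(** The left side is the value of [calib * u ^+ 2] at phase [a], where [prof] is [u * sin a] and
    [dprof] is [u * cos a - 1]. The factor [u ^+ 2] keeps it meaningful for [u = 0], when [prof]
    vanishes at phase [a]. *)
Lemma calib_end (u a p l : R) : 0 <= u -> 0 < a < pi -> 0 < p -> 0 <= l ->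
  p * l / 2 < a ->
  p * (u * (u * cos a - 1)) / sin a <= calib u a p l * u ^+ 2.
Proof.
move=> u0 api p0 l0 la; have s0 := sin_gt0_pi api; case/andP: (api) => a0 ap.
have l20 : 0 <= p * l / 2 by rewrite divr_ge0// mulr_ge0// ltW.
have Wl : 0 < prof u a (p * l / 2) by apply: prof_gt0; rewrite // l20.
rewrite /calib -mulrA -[leRHS]mulrA ler_pM2l// [leRHS]mulrC mulrA ler_pdivrMr//.
rewrite [leRHS]mulrAC ler_pdivlMr//.
move: l20 Wl la; set s := p * l / 2 => l20 Wl sa.
rewrite -subr_ge0.
have -> : u ^+ 2 * dprof u a s * sin a - u * (u * cos a - 1) * prof u a s =
    u * (chord2 u a * sin (a - s)).
  rewrite /dprof /prof /chord2 !sinB !cosB.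
  ring: (sin2cos2 a) (sin2cos2 s).
rewrite mulr_ge0// mulr_ge0 ?(ltW (chord2_gt0 _ _))// sin_ge0_pi// subr_ge0 ltW//.
by rewrite (le_trans _ (ltW ap))// gerBl.
Qed.

End Calibration.

(** * Measurability and arclength of C^1 curves *)

Section Length.
Variable R : realType.
Implicit Types (X V : R -> R).

Local Notation mu := (@lebesgue_measure R).

Lemma measurable_invr : measurable_fun [set: R] (@GRing.inv R).
Proof.
rewrite (_ : [set: R] = [set 0] `|` ~` [set 0]); last by rewrite setUCr.
apply/measurable_funU => //; [exact: measurableC|split; first exact: measurable_fun_set1].
apply: open_continuous_measurable_fun => [|x].
  by apply: closed_openC; exact: closed_eq.
by rewrite inE/= => /eqP x0; exact: inv_continuous.
Qed.

Lemma continuous_speed2 X V : C1 X -> C1 V ->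
  continuous (fun t => Num.sqrt (derive1 X t ^+ 2 + derive1 V t ^+ 2)).
Proof.
move=> [_ cX] [_ cV] t.
apply: (@continuous_comp _ _ _ (fun t => derive1 X t ^+ 2 + derive1 V t ^+ 2)).
  apply: continuousD.
    apply: (@continuous_comp _ _ _ (derive1 X) (fun x : R => x ^+ 2)).
      exact: cX.
    exact: exprn_continuous.
  apply: (@continuous_comp _ _ _ (derive1 V) (fun x : R => x ^+ 2)).
      exact: cV.
    exact: exprn_continuous.
exact: sqrt_continuous.
Qed.

Lemma C1_continuous X : C1 X -> continuous X.
Proof.
by move=> [dX _] t; apply/differentiable_continuous/derivable1_diffP; exact: dX.
Qed.

Lemma measurable_speedH X V : C1 X -> C1 V -> measurable_fun [set: R] (speedH X V).
Proof.
move=> hX hV.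
have mV := continuous_measurable_fun (C1_continuous hV).
have ms := continuous_measurable_fun (continuous_speed2 hX hV).
apply: measurable_fun_ifT; first exact: measurable_fun_eqr.
  by apply: measurable_fun_ifT => //; exact: measurable_fun_eqr.
apply/measurable_EFinP; apply: measurable_funM => //.
apply: (measurableT_comp measurable_invr).
apply: (measurableT_comp _ mV).
by apply: continuous_measurable_fun; exact: sqrt_continuous.
Qed.

Lemma speedH_ge0 X V t : (0 <= speedH X V t)%E.
Proof.
rewrite /speedH; case: ifP => _; first by case: ifP.
by rewrite lee_fin divr_ge0 ?sqrtr_ge0.
Qed.

Lemma lengthH_ge0 X V : (0 <= lengthH X V)%E.
Proof. by apply: integral_ge0 => t _; exact: speedH_ge0. Qed.

(** Integrating from -1 puts [0, 1] in the interior, so the derivatives are two-sided at 0 and 1 as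
    well. *)
Lemma continuous_primitive (s : R -> R) : continuous s ->
  {l : R -> R | forall t : R, -1 < t < 2 -> is_derive t 1 l (s t)}.
Proof.
move=> cs; exists (fun y => \int[mu]_(t in `[-1, y]) s t)%R => t /andP[t1 t2].
have fi : mu.-integrable `[-1, 2] (EFin \o s).
  apply: continuous_compact_integrable; first exact: segment_compact.
  exact: continuous_subspaceT.
have [dl ld] := continuous_FTC1_closed t2 fi t1 (cs t).
by apply: DeriveDef; [exact: dl|rewrite -derive1E; exact: ld].
Qed.

(* Raising the curve by [e] makes the speed continuous and does not increase
   the length, even where the curve touches the boundary. *)
Lemma raised_length_le X V (e : R) : C1 X -> C1 V ->
  (forall t : R, 0 <= t <= 1 -> 0 <= V t) -> 0 < e ->
  exists l s : R -> R,
  [/\ forall t : R, 0 <= t <= 1 -> is_derive t 1 l (s t),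
      forall t : R, 0 <= t <= 1 -> 0 <= s t /\
        s t ^+ 2 * (V t + e) = derive1 X t ^+ 2 + derive1 V t ^+ 2,
      l 0 = 0 & ((l 1)%:E <= lengthH X V)%E].
Proof.
move=> hX hV V0 e0.
(* [V] is nonnegative on [0, 1] only; the absolute value makes the density continuous on the whole
   line. *)
pose s t := Num.sqrt (derive1 X t ^+ 2 + derive1 V t ^+ 2) / Num.sqrt (`|V t| + e).
have Ve t : 0 < `|V t| + e by rewrite ltr_wpDl.
have cs : continuous s.
  move=> t; apply: (@continuousM _ _ (fun t => Num.sqrt (derive1 X t ^+ 2 +
    derive1 V t ^+ 2)) (fun t => (Num.sqrt (`|V t| + e))^-1)).
    exact: continuous_speed2.
  apply: (@continuousV _ _ (fun t => Num.sqrt (`|V t| + e))).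
    by rewrite lt0r_neq0 ?sqrtr_gt0.
  apply: (@continuous_comp _ _ _ (fun t => `|V t| + e)); last exact: sqrt_continuous.
  apply: (@continuousD _ _ _ (fun t => `|V t|) (fun=> e)); last exact: cst_continuous.
  apply: (@continuous_comp _ _ _ V (@Num.norm _ R)); last exact: norm_continuous.
  exact: C1_continuous.
have [l hl] := continuous_primitive cs.
have hl' (t : R) : 0 <= t <= 1 -> is_derive t 1 l (s t).
  by move=> /andP[t0 t1]; apply: hl; rewrite (lt_le_trans _ t0)//= (le_lt_trans t1)// ltr1n.
exists (fun t => l t - l 0), s; split.
- move=> t t01; have ? := hl' t t01; rewrite -[s t]subr0.
  by apply: is_derive_funD => //; apply: is_derive_funN; exact: is_derive_fun_cst.
- move=> t t01; split; first by rewrite divr_ge0 ?sqrtr_ge0.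
  rewrite /s expr_div_n (sqr_sqrtr (ltW (Ve t))) sqr_sqrtr ?addr_ge0 ?sqr_ge0//.
  have := Ve t; rewrite (ger0_norm (V0 t t01)) => /lt0r_neq0 Vn0.
  by rewrite divfK.
- by rewrite subrr.
- rewrite EFinB -(@continuous_FTC2 _ s l 0 1)//; last 3 first.
  + exact: continuous_subspaceT.
  + have cl (t : R) : 0 <= t <= 1 -> {for t, continuous l}.
      by move=> /hl'; exact: is_derive_continuous.
    split=> [t|  |].
    * by rewrite in_itv/= => /andP[/ltW t0 /ltW t1]; case: (hl' t); rewrite ?t0.
    * by apply: cvg_at_right_filter; apply: cl; lra.
    * by apply: cvg_at_left_filter; apply: cl; lra.
  + move=> t; rewrite in_itv/= => /andP[/ltW t0 /ltW t1].
    by rewrite derive1E; case: (hl' t); rewrite ?t0.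
  apply: ge0_le_integral => //.
  + by move=> t _; rewrite lee_fin divr_ge0 ?sqrtr_ge0.
  + apply/measurable_EFinP/measurable_funTS; exact: continuous_measurable_fun.
  + by apply: measurable_funTS; exact: measurable_speedH.
  + move=> t /=; rewrite in_itv/= => t01; rewrite /speedH /s.
    (* On the boundary [speedH] is infinite unless the numerator is 0, and then [s] is 0 too. *)
    case: eqVneq => [_|Vt0].
      by case: eqP => [->|_]; rewrite ?mul0r ?leey.
    have Vt : 0 < V t by rewrite lt_neqAle eq_sym Vt0 V0.
    rewrite lee_fin ler_wpM2l ?sqrtr_ge0// lef_pV2 ?posrE ?sqrtr_gt0//.
    by rewrite ler_wsqrtr// ger0_norm ?(ltW Vt)// lerDl ltW.
Qed.

End Length.

(** * Lower bound for the distance *)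

Section LowerBound.
Variable R : realType.
Implicit Types (X V : R -> R).

(** The condition [p * L / 2 < a] keeps the phase where [prof] is positive, so [calib] solves the
    Riccati equation along the whole raised curve. Only [P ^+ 2] is fixed, so that the sign of [P]
    can follow the direction of travel in x. *)
Lemma raised_calibration X V (u a p P e L : R) : 0 <= u -> 0 < a < pi ->
  0 < p -> P ^+ 2 = p ^+ 2 -> 0 < e -> C1 X -> C1 V ->
  (forall t : R, 0 <= t <= 1 -> 0 <= V t) ->
  lengthH X V = L%:E -> p * L / 2 < a ->
  2 * P * (X 1 - X 0) + 2 * calib u a p L * (V 1 + e)
    - 2 * calib u a p 0 * (V 0 + e) <= L.
Proof.
move=> u0 api p0 Pp e0 hX hV V0 LE pL.
have [l [s [dl ds l0 l1L]]] := raised_length_le hX hV V0 e0.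
have {l1L} l1L : l 1 <= L by rewrite LE lee_fin in l1L.
have mono (x y : R) : 0 <= x -> x <= y -> y <= 1 -> l x <= l y.
  move=> x0 xy y1; apply: (ger0_is_derive_le xy (g := s)) => z /andP[xz zy].
    by apply: dl; rewrite (le_trans x0)//= (le_trans zy).
  by apply ds; rewrite (le_trans x0)//= (le_trans zy).
have lt_a x : x <= L -> p * x / 2 < a.
  by move=> xL; rewrite (le_lt_trans _ pL)// ler_pM2r ?invr_gt0// ler_pM2l.
have lb (t : R) : 0 <= t <= 1 -> 0 <= l t <= L.
  move=> /andP[t0 t1]; rewrite -{1}l0 mono//=.
  exact: le_trans (mono _ _ t0 t1 (lexx _)) l1L.
have ap : a < pi by case/andP: api.
have cal : l 0 - 2 * P * X 0 - 2 * calib u a p (l 0) * (V 0 + e)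
    <= l 1 - 2 * P * X 1 - 2 * calib u a p (l 1) * (V 1 + e).
  apply: (@calibrated_length _ X (fun t => V t + e) l (derive1 X) (derive1 V) s
      (calib u a p) P) => t t01.
  - by rewrite derive1E; apply/derivableP; case: hX => /(_ t).
  - rewrite -[derive1 V t]addr0; apply: (is_derive_funD _ (is_derive_fun_cst e t)).
    by rewrite derive1E; apply/derivableP; case: hV => /(_ t).
  - by have [? ?] := ds t t01; split=> //; rewrite addr_ge0 ?V0// ltW.
  - have /andP[lt0 ltL] := lb t t01.
    rewrite Pp; apply: is_derive_calib; apply/lt0r_neq0/prof_gt0 => //.
    by rewrite lt_a// divr_ge0// mulr_ge0// ltW.
have i1 : 0 <= (1 : R) <= 1 by rewrite ler01 lexx.
have /andP[l10 _] := lb 1 i1.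
(* The raised curve may be shorter than [L]; monotonicity replaces its unknown length [l 1] by
   [L]. *)
have cL : calib u a p L <= calib u a p (l 1) by apply: calib_le.
have V1 : 0 <= V 1 + e by rewrite addr_ge0 ?(ltW e0)// V0.
have := ler_wpM2r V1 cL; rewrite l0 in cal.
nra.
Qed.

(* The distance from (0, 1) to the point (x, u^2) with delta = 2 a. *)
Definition cycloid_length (u a : R) : R := 2 * a * Num.sqrt (chord2 u a) / sin a.

Lemma dH_ge (s u a x : R) : s ^+ 2 = 1 -> 0 <= u -> 0 < a < pi ->
  s * x = fH_angle u a ->
  ((cycloid_length u a)%:E <= dH ((0, 1) : R * R)%R (x, u ^+ 2)%R)%E.
Proof.
move=> s1 u0 api sx; apply: le_ereal_inf_tmp.
move=> _ [X [V [[hX hV V0 [X0 V0E] [X1 V1]] ->]]].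
rewrite leNgt; apply/negP => LD.
have sa := sin_gt0_pi api; have Q0 := chord2_gt0 u api.
have [L LE] : {L | lengthH X V = L%:E}.
  exists (fine (lengthH X V)); rewrite fineK// ge0_fin_numE ?lengthH_ge0//.
  exact: lt_trans LD (ltry _).
have L0 : 0 <= L by rewrite -lee_fin -LE lengthH_ge0.
rewrite LE lte_fin in LD.
pose r := Num.sqrt (chord2 u a).
have r0 : 0 < r by rewrite sqrtr_gt0.
have r2 : r ^+ 2 = chord2 u a by rewrite sqr_sqrtr ?(ltW Q0).
(* This rate makes the phase reach exactly [a] at arclength [cycloid_length u a]. *)
pose p := sin a / r; have p0 : 0 < p by rewrite divr_gt0.
have pD : p * cycloid_length u a / 2 = a.
  by rewrite /p /cycloid_length -/r; field; rewrite !lt0r_neq0.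
have pL : p * L / 2 < a by rewrite -[ltRHS]pD ltr_pM2r ?invr_gt0// ltr_pM2l.
have c0 : calib u a p 0 = p * (u - cos a) / sin a.
  by rewrite /calib /prof /dprof mulr0 mul0r subr0 sin0 cos0 mulr0 addr0 mulr1 mulrA.
have cu := calib_end u0 api p0 L0 pL.
(* The calibration inequality is an equality for the cycloid itself. *)
have DE : cycloid_length u a - 2 * p * fH_angle u a
    - 2 * (p * (u * (u * cos a - 1)) / sin a)
    + 2 * (p * (u - cos a) / sin a) = 0.
  rewrite /cycloid_length /fH_angle -/r -r2 /p; field.
  by rewrite !lt0r_neq0.
(* Raising the curve by [e] costs only a term linear in [e]. *)
have bound e : 0 < e -> cycloid_length u a - L <=
    2 * e * (calib u a p 0 - calib u a p L).
  move=> e0.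
  have := @raised_calibration X V u a p (s * p) e L u0 api p0 _ e0 hX hV V0 LE pL.
  rewrite exprMn s1 mul1r X0 X1 V0E V1 subr0 => /(_ erefl) B.
  rewrite (_ : 2 * (s * p) * x = 2 * p * (s * x)) in B; last by ring.
  rewrite sx in B; rewrite -c0 in DE; nra.
pose K := calib u a p 0 - calib u a p L.
have K0 : 0 <= K by rewrite subr_ge0 calib_le.
have K1 : 0 < 2 * (K + 1) by rewrite mulr_gt0// ltr_wpDl.
have d0 : 0 < cycloid_length u a - L by rewrite subr_gt0.
(* With [e] equal to the gap divided by [2 * (K + 1)], the bound forces the gap to be at most
   [K / (K + 1)] of itself. The added 1 covers [K = 0]. *)
have := bound _ (divr_gt0 d0 K1); rewrite -/K leNgt => /negP; apply.
rewrite (_ : _ * K = (cycloid_length u a - L) * (K / (K + 1))); last first.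
  by field; rewrite lt0r_neq0// ltr_wpDl.
by rewrite gtr_pMr// ltr_pdivrMr ?ltr_wpDl// mul1r ltrDl.
Qed.

(** By [chord2E], [chord2 u a] is at least [sin a ^+ 2]. *)
Lemma cycloid_length_ge (u a : R) : 0 < a < pi -> 2 * a <= cycloid_length u a.
Proof.
move=> api; have sa := sin_gt0_pi api; have a0 : 0 < a by case/andP: api.
rewrite /cycloid_length ler_pdivlMr// ler_pM2l ?mulr_gt0//.
rewrite -[leLHS](gtr0_norm sa) -sqrtr_sqr ler_wsqrtr// chord2E.
by rewrite lerDl sqr_ge0.
Qed.

(** For [cos a <= 0] the cross term of [chord2] is nonnegative, so the minimum 1 is at [u = 0]. *)
Lemma cycloid_length_ge_obtuse (u a : R) : 0 <= u -> 0 < a < pi -> cos a <= 0 ->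
  2 * a / sin a <= cycloid_length u a.
Proof.
move=> u0 api ca; have sa := sin_gt0_pi api; have a0 : 0 < a by case/andP: api.
rewrite /cycloid_length ler_pM2r ?invr_gt0// ler_peMr ?mulr_ge0 ?(ltW a0)//.
rewrite -[leLHS]sqrtr1 ler_wsqrtr// /chord2 -addrA lerDl addr_ge0 ?sqr_ge0//.
by rewrite oppr_ge0 mulr_ge0_le0// mulr_ge0.
Qed.

End LowerBound.

(** * Extremal cycloids and level sets *)

Section UpperBound.
Variable R : realType.

(** The curve has constant speed [D] off the boundary. Where [V] vanishes the hypothesis makes the
    velocity vanish, so [speedH] takes its finite value 0 there. *)
Lemma dH_le (X V dX dV : R -> R) (D : R) :
  (forall t : R, is_derive t 1 X (dX t)) -> continuous dX ->
  (forall t : R, is_derive t 1 V (dV t)) -> continuous dV ->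
  (forall t : R, 0 <= V t) -> 0 <= D ->
  (forall t : R, dX t ^+ 2 + dV t ^+ 2 = D ^+ 2 * V t) ->
  (dH (X 0, V 0)%R (X 1, V 1)%R <= D%:E)%E.
Proof.
move=> hX cX hV cV V0 D0 XV.
have C1X := is_derive_C1 hX cX; have C1V := is_derive_C1 hV cV.
apply: (@le_trans _ _ (lengthH X V)).
  apply: ereal_inf_lbound; exists X, V; split=> //.
have -> : D%:E = (\int[@lebesgue_measure R]_(t in `[0%R, 1%R]) cst D%:E t)%E.
  rewrite integral_cst//= lebesgue_measure_itv/= lte_fin ltr01.
  by rewrite -EFinD subr0 mule1.
apply: ge0_le_integral => //.
- by move=> t _; exact: speedH_ge0.
- by apply: measurable_funTS; exact: measurable_speedH.
- move=> t _ /=; rewrite /speedH !derive1E.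
  have [_ ->] := hX t; have [_ ->] := hV t; rewrite XV.
  case: eqVneq => [->|Vt]; first by rewrite mulr0 sqrtr0 eqxx.
  rewrite sqrtrM ?sqr_ge0// sqrtr_sqr ger0_norm// mulfK ?lexx//.
  by rewrite sqrtr_eq0 -ltNge lt_neqAle eq_sym Vt V0.
Qed.

Lemma continuous_sincos (k b c : R) (f g : R -> R) :
  (f = @sin R \/ f = @cos R) -> (g = @sin R \/ g = @cos R) ->
  continuous (fun t => k * (f (b * t + c) * g (b * t + c))).
Proof.
move=> hf hg t.
have lin : {for t, continuous (fun t : R => b * t + c)}.
  by apply: (@is_derive_continuous _ _ _ b); derive_fun; ring.
have ct h : (h = @sin R \/ h = @cos R) -> {for t, continuous (fun t => h (b * t + c))}.
  by case=> ->; apply: (continuous_comp lin);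
    [exact: continuous_sin|exact: continuous_cos].
apply: (@continuousM _ _ (fun=> k) (fun t => f (b * t + c) * g (b * t + c))).
  exact: cst_continuous.
by apply: (@continuousM _ _ (fun t => f (b * t + c)) (fun t => g (b * t + c))); exact: ct.
Qed.

(* At (0, 1) this cycloid is at its apex. *)
Lemma dH_apex_le (a : R) :
  (dH ((0, 1) : R * R)%R (a + sin a * cos a, cos a ^+ 2)%R <= (`|2 * a|)%:E)%E.
Proof.
pose X t := a * t + sin (a * t) * cos (a * t).
pose V t := cos (a * t) ^+ 2.
have -> : ((0, 1) : R * R) = (X 0, V 0).
  by rewrite /X /V mulr0 sin0 cos0 mul0r addr0 expr1n.
have -> : (a + sin a * cos a, cos a ^+ 2) = (X 1, V 1) by rewrite /X /V mulr1.
(* The [+ 0] brings the velocities into the form required by [continuous_sincos]. *)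
apply: (@dH_le X V (fun t => 2 * a * (cos (a * t + 0) * cos (a * t + 0)))
  (fun t => - (2 * a) * (sin (a * t + 0) * cos (a * t + 0)))).
- by move=> t; rewrite /X addr0; derive_fun; ring: (sin2cos2 (a * t)).
- by apply: continuous_sincos; right.
- by move=> t; rewrite /V addr0; derive_fun; ring.
- by apply: continuous_sincos; [left|right].
- by move=> t; exact: sqr_ge0.
- exact: normr_ge0.
- by move=> t; rewrite /V addr0 real_normK ?num_real//; ring: (sin2cos2 (a * t)).
Qed.

(* The cycloid reaching the boundary at its cusp. *)
Lemma dH_cusp_le (a : R) : sin a != 0 ->
  (dH ((0, 1) : R * R)%R ((a - sin a * cos a) / sin a ^+ 2, 0)%R <=
   (`|2 * a / sin a|)%:E)%E.
Proof.
move=> s0.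
(* The phase [- a * t + a] runs from [a] down to 0, and dividing by [sin a ^+ 2] scales the starting
   height to 1. *)
pose X t := (a * t + sin (- a * t + a) * cos (- a * t + a) - sin a * cos a) / sin a ^+ 2.
pose V t := sin (- a * t + a) ^+ 2 / sin a ^+ 2.
have -> : ((0, 1) : R * R) = (X 0, V 0).
  by rewrite /X /V !mulr0 !add0r subrr mul0r divff ?expf_neq0.
have -> : ((a - sin a * cos a) / sin a ^+ 2, 0) = (X 1, V 1).
  by rewrite /X /V !mulr1 addNr sin0 !mul0r addr0 expr0n mul0r.
apply: (@dH_le X V
  (fun t => 2 * a / sin a ^+ 2 * (sin (- a * t + a) * sin (- a * t + a)))
  (fun t => - (2 * a / sin a ^+ 2) * (sin (- a * t + a) * cos (- a * t + a)))).
- move=> t; rewrite /X; derive_fun; first by rewrite expf_neq0.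
  by field: (sin2cos2 (- a * t + a)).
- by apply: continuous_sincos; left.
- by move=> t; rewrite /V; derive_fun; [by rewrite expf_neq0|field].
- by apply: continuous_sincos; [left|right].
- by move=> t; rewrite divr_ge0 ?sqr_ge0.
- exact: normr_ge0.
- by move=> t; rewrite /V real_normK ?num_real//; field: (sin2cos2 (- a * t + a)).
Qed.

End UpperBound.

(** * Level sets and the two minimizing points *)

Section LevelSets.
Variable R : realType.

Lemma Dhat_eq (th D x v : R) : Gamma th (x, v) ->
  (dH (0, 1)%R (x, v) <= D%:E)%E ->
  (forall p, Gamma th p -> (D%:E <= dH (0, 1)%R p)%E) ->
  Dhat th = D%:E /\ dH (0, 1) (x, v) = D%:E.
Proof.
move=> Gxv leD geD.
have dE : dH (0, 1) (x, v) = D%:E by apply/eqP; rewrite eq_le leD geD.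
split=> //; apply/eqP; rewrite eq_le; apply/andP; split.
  by apply: ereal_inf_lbound; exists (x, v).
by apply: le_ereal_inf_tmp => _ [p Gp <-]; exact: geD.
Qed.

Lemma Gamma_fH (th x v : R) : - (2 * pi) < th < 2 * pi -> 0 <= v ->
  fH v th = x -> Gamma th (x, v).
Proof.
move=> hth v0 fx; split=> //; split=> //; split=> //= d hd fd.
by apply: (fH_inj v0 hd hth); rewrite fd.
Qed.

(** Here [u] is [Num.sqrt p.2], and oddness of [fH] in its second argument carries the sign [s] over
    to x. *)
Lemma dH_Gamma_ge (s a : R) p : s = 1 \/ s = -1 -> 0 < a < pi ->
  Gamma (s * (2 * a)) p ->
  ((cycloid_length (Num.sqrt p.2) a)%:E <= dH (0, 1)%R p)%E.
Proof.
case: p => x v hs api [/= v0 [_ [fx _]]].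
have := fH_half (sqrtr_ge0 v) api; rewrite sqr_sqrtr// => fv.
rewrite -[in leRHS](sqr_sqrtr v0).
apply: (dH_ge (s := s)) => //; first by case: hs => ->; rewrite ?sqrrN expr1n.
by rewrite -fx -fv; case: hs => ->; rewrite ?mul1r// !mulN1r fHN opprK.
Qed.

Lemma fH_apex (th : R) : `|th| < pi ->
  fH (cos (th / 2) ^+ 2) th = (th + sin th) / 2.
Proof.
wlog th0 : th / 0 <= th.
  move=> H; have [th0|/ltW th0] := leP 0 th; first exact: H.
  rewrite -normrN => thpi; have := H (- th); rewrite oppr_ge0 => /(_ th0 thpi).
  by rewrite mulNr cosN sinN fHN -opprD mulNr => /oppr_inj.
rewrite ger0_norm//; case: (eqVneq th 0) => [-> _|tn0 thpi].
  by rewrite /fH eqxx sin0 addr0 mul0r.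
have a0 : 0 < th / 2 by rewrite divr_gt0// lt_neqAle eq_sym tn0.
have api : th / 2 < pi.
  by rewrite ltr_pdivrMr// (lt_le_trans thpi)// ler_peMr ?pi_ge0// ler1n.
(* The minimizer [u = cos a] must be nonnegative for [fH_half]; this is where [th < pi] enters. *)
have ca : 0 < cos (th / 2).
  apply: cos_gt0_pihalf; rewrite ltr_pM2r ?invr_gt0// thpi andbT.
  by rewrite (lt_trans _ a0)// oppr_lt0 divr_gt0 ?pi_gt0.
have thE : th = 2 * (th / 2) by field.
rewrite {2 3 4}thE; move: (th / 2) a0 api ca => a a0 api ca.
have s0 : sin a != 0 by rewrite lt0r_neq0// sin_gt0_pi// a0.
rewrite fH_half ?(ltW ca) ?a0// mulr_natl sin_mulr2n /fH_angle /chord2.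
by field: (sin2cos2 a).
Qed.

Lemma fH_cusp (s a : R) : s = 1 \/ s = -1 -> 0 < a < pi ->
  fH 0 (s * (2 * a)) = s * ((a - sin a * cos a) / sin a ^+ 2).
Proof.
move=> hs api; have s0 := lt0r_neq0 (sin_gt0_pi api).
have f0 : fH 0 (2 * a) = (a - sin a * cos a) / sin a ^+ 2.
  have := fH_half (lexx 0) api; rewrite expr0n => ->.
  by rewrite /fH_angle /chord2; field.
by case: hs => ->; rewrite ?mul1r// !mulN1r fHN f0.
Qed.

Lemma cos_le0_obtuse (a : R) : pi / 2 <= a <= pi -> cos a <= 0.
Proof.
move=> /andP[a1 a2]; rewrite -oppr_ge0 -sinBpihalf sin_ge0_pi// subr_ge0 a1/=.
by rewrite (le_trans _ a2)// gerBl divr_ge0 ?pi_ge0.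
Qed.

Lemma dH_ge0 (p q : R * R) : (0 <= dH p q)%E.
Proof.
by apply: le_ereal_inf_tmp => _ [X [V [_ ->]]]; exact: lengthH_ge0.
Qed.

Lemma sign_half (th : R) : th != 0 ->
  exists s a, [/\ s = 1 \/ s = -1, 0 < a, th = s * (2 * a) & `|th| = 2 * a].
Proof.
move=> th0; exists (Num.sg th), (`|th| / 2); have E : 2 * (`|th| / 2) = `|th| by field.
split; last by rewrite E.
- by case: (ltgtP th 0) th0 => // h _; [right; exact: ltr0_sg|left; exact: gtr0_sg].
- by rewrite divr_gt0 ?normr_gt0.
- by rewrite E -numEsg.
Qed.

End LevelSets.

Unset Implicit Arguments.

Theorem theorem2p3 (R : realType) (th : R) (hth : - (2 * pi) < th < 2 * pi) :
  (`|th| < pi ->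
     Dhat th = (`|th|)%:E /\
     dH ((0 : R), (1 : R)) ((th + sin th) / 2, cos (th / 2) ^+ 2) = (`|th|)%:E) /\
  (pi <= `|th| ->
     Dhat th = (th / sin (th / 2))%:E /\
     dH ((0 : R), (1 : R)) ((th - sin th) / (1 - cos th), 0) = (th / sin (th / 2))%:E).
Proof.
have sin2 a : sin (2 * a) = 2 * sin a * cos a :> R.
  by rewrite mulr_natl sin_mulr2n mulr2n; ring.
split=> hpi.
- apply: Dhat_eq.
  + by apply: Gamma_fH; rewrite ?sqr_ge0// fH_apex.
  + have := dH_apex_le (th / 2); rewrite (_ : 2 * (th / 2) = th); last by field.
    rewrite (_ : th / 2 + _ = (th + sin th) / 2)//.
    by rewrite [in RHS](_ : th = 2 * (th / 2)) ?sin2; field.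
  (* For [th = 0] the half-angle formulas degenerate, but the bound is then just nonnegativity of
     the distance. *)
  + move=> p Gp; case: (eqVneq th 0) => [->|/sign_half[s [a [hs a0 thE nE]]]].
      by rewrite normr0 dH_ge0.
    have api : 0 < a < pi.
      rewrite a0 (lt_le_trans _ (ltW (_ : 2 * a < pi))) -?nE// nE.
      by rewrite ltr_pMl ?ltr1n.
    rewrite thE in Gp; apply: le_trans (dH_Gamma_ge hs api Gp).
    by rewrite lee_fin nE cycloid_length_ge.
- have /sign_half[s [a [hs a0 thE nE]]] : th != 0.
    by rewrite -normr_gt0 (lt_le_trans (pi_gt0 _)).
  have api : 0 < a < pi.
    rewrite a0 -(@ltr_pM2l _ 2)// -nE ltr_norml.
    by case/andP: hth => -> ->.
  have s0 := lt0r_neq0 (sin_gt0_pi api).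
  have th2 : th / 2 = s * a by rewrite thE; field.
  have ss : sin (s * a) = s * sin a by case: hs => ->; rewrite ?mul1r// !mulN1r sinN.
  (* The quotient is even in [th], so the sign [s] cancels. *)
  have DE : th / sin (th / 2) = 2 * a / sin a.
    by rewrite th2 ss thE; case: hs => ->; rewrite ?mul1r// !mulN1r invrN mulrNN.
  have xE : (th - sin th) / (1 - cos th) = s * ((a - sin a * cos a) / sin a ^+ 2).
    have c2 : 1 - cos (2 * a) = 2 * sin a ^+ 2.
      by rewrite mulr_natl cos_mulr2n mulr2n; ring: (sin2cos2 a).
    rewrite thE; case: hs => ->; rewrite ?mul1r ?mulN1r ?sinN ?cosN sin2 c2; by field.
  rewrite DE; apply: Dhat_eq.
  + by apply: Gamma_fH => //; rewrite xE thE fH_cusp.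
  + have ssa : sin (s * a) != 0.
      by rewrite ss; case: hs => ->; rewrite ?mul1r ?mulN1r ?oppr_eq0.
    have := dH_cusp_le ssa; rewrite xE.
    have cs : cos (s * a) = cos a by case: hs => ->; rewrite ?mul1r// mulN1r cosN.
    have -> : (s * a - sin (s * a) * cos (s * a)) / sin (s * a) ^+ 2 =
       s * ((a - sin a * cos a) / sin a ^+ 2).
      by rewrite ss cs; case: hs => ->; field.
    have -> : `|2 * (s * a) / sin (s * a)| = 2 * a / sin a => //.
    rewrite ss (_ : _ / _ = 2 * a / sin a); last by case: hs => ->; field.
    by rewrite ger0_norm// divr_ge0 ?(ltW (sin_gt0_pi api))// mulr_ge0// ltW.
  + move=> p; rewrite thE => Gp; apply: le_trans (dH_Gamma_ge hs api Gp).
    (* The hypothesis on [th] places [a] in [pi/2, pi), where the cosine is nonpositive. *)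
    rewrite lee_fin cycloid_length_ge_obtuse ?sqrtr_ge0// cos_le0_obtuse//.
    by rewrite ler_pdivrMr// mulrC -nE hpi; case/andP: api => _ /ltW.
Qed.
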